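(* Let $b\ge 3$ be an integer, let $D$ be a proper subset of $\{0,1,\dots,b-1\}$ with at least two elements, and let $C$ be the set of real numbers in $[0,1]$ whose base $b$ expansion involves only digits from $D$. Then there is a constant $c_1$, depending only on $b$ and $D$, with the following property. For any $\epsilon>0$ and any function $\Psi\colon\mathbb{N}\to(0,1]$ (where $\mathbb{N}$ is the set of positive integers), there exists $\xi\in C$ whose convergents $p/q\in\mathbb{Q}$ (written in reduced form) with denominator $q\ge c_1$ all lie in $C$ and satisfy \[ \min\{\Psi(q),\,q^{-q}\} > \left|\xi-\frac{p}{q}\right| > c_2\,q^{-(1+\epsilon)q}\,\Psi(q) \] for a constant $c_2=c_2(b,\epsilon)>0$. Moreover, if $D$ contains $\{0,1\}$, one may take $c_1=1$, so that all convergents of $\xi$, starting with $0/1$, belong to $C$.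
   Context: The convergents of a real number $\xi$ are the rational numbers obtained by truncating its (simple) continued fraction expansion. *)

(* Defs.v *)
From mathcomp Require Export all_boot all_order all_algebra.
From mathcomp Require Export all_classical all_reals all_analysis.
Export Order.TTheory GRing.Theory Num.Theory.
Export numFieldNormedType.Exports.

Set Implicit Arguments.
Unset Strict Implicit.
Unset Printing Implicit Defensive.

Local Open Scope classical_set_scope.
Local Open Scope ring_scope.

(* It suffices that one base b expansion of x uses only digits from D; a b-adic
   rational has two expansions. *)
Definition missing_digit_set (R : realType) (b : nat) (D : {set 'I_b}) : set R :=
  [set x : R | 0 <= x <= 1 /\
    exists2 d : nat -> 'I_b, (forall k, d k \in D) &
      series (fun k : nat => (d k)%:R / b%:R ^+ k.+1 : R) @ \oo --> x].

(* The value [a_0; a_1, ..., a_n] of the continued fraction expansion of x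
   truncated at depth n. The expansion of a rational number is finite, and
   truncating it beyond its end returns the number itself. *)
Fixpoint cf_trunc (R : realType) (x : R) (n : nat) : rat :=
  let a := Num.floor x in
  if n isn't m.+1 then a%:~R
  else if x == a%:~R then a%:~R
  else a%:~R + (cf_trunc (x - a%:~R)^-1 m)^-1.

Definition convergents (R : realType) (x : R) : set rat := range (cf_trunc x).

(* The denominator of a rational number in reduced form, as a natural number. *)
Definition den (r : rat) : nat := `|denq r|%N.

(* Main.v *)
(** Fix a word v over D and let z = 0.vvv... . If p/q = 0.www... has denominator
prime to b and z is suitably placed below it, then the number A = P/Q whose
expansion is w repeated many times, followed by v v v ..., satisfies
p Q - q P = 1; and the purely periodic number whose period is the (long)
nonperiodic part of A followed by copies of v is again such a p'/q', with
p' Q - q' P = 1. The lengths of the repetitions are free, so the denominators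
can be made to grow as fast as prescribed, up to a polynomial factor in the
previous denominator. Alternating the two steps gives nested intervals
]P/Q, p/q[ with Farey neighbours as end points, hence fractions that are
consecutive convergents of the common point, all of them in the digit set.

If 0 and 1 are in D, take v = 0 and start from p/q = 1/(b^n - 1), whose preceding
convergent is 0/1. For digits d < c of D in general, write c - d = f g with f | b^a
and g prime to b, choose t with b^t = 1 modulo (b - 1)^2 g, and take v = c...cd of
length t: then 0.vvv... = u/y with y = (b^t - 1)/g, and the word c^t v^k is, for a
suitable k, the period of a starting p/q. *)

Require Import Defs.
From mathcomp Require Import cyclic zify ring lra.

Set Implicit Arguments.
Unset Strict Implicit.
Unset Printing Implicit Defensive.

Local Open Scope nat_scope.

(** * Words and their values *)

Definition word_val (b : nat) (s : seq 'I_b) : nat :=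
  foldl (fun v (d : 'I_b) => v * b + d) 0 s.

Definition geo (x n : nat) : nat := \sum_(i < n) x ^ i.

Definition word_pow (T : Type) (n : nat) (s : seq T) : seq T := flatten (nseq n s).

Lemma word_val_cat b (s t : seq 'I_b) :
  word_val (s ++ t)%SEQ = word_val s * b ^ size t + word_val t.
Proof.
elim/last_ind: t => [|t d IH]; first by rewrite cats0 expn0 muln1 addn0.
rewrite -rcons_cat /word_val !foldl_rcons -!/(word_val _) IH size_rcons expnS.
ring.
Qed.

Lemma geo0 x : geo x 0 = 0. Proof. exact: big_ord0. Qed.

Lemma geoS x n : geo x n.+1 = 1 + x * geo x n.
Proof.
rewrite /geo big_ord_recl expn0 big_distrr; congr addn.
by apply: eq_bigr => i _; rewrite /= /bump /= add1n expnS.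
Qed.

Lemma geoD x m n : geo x (m + n) = geo x m + x ^ m * geo x n.
Proof.
elim: m => [|m IH]; first by rewrite geo0 mul1n.
by rewrite addSn !geoS IH expnS; ring.
Qed.

Lemma geo_pred x n : 0 < x -> geo x n * x.-1 + 1 = x ^ n.
Proof.
case: x => // x _ /=; elim: n => [|n IH]; first by rewrite geo0 expn0.
by rewrite geoS expnS -IH; ring.
Qed.

Lemma geo_mod x y n : x = 1 %[mod y] -> geo x n = n %[mod y].
Proof.
move=> h; elim: n => [|n IH]; first by rewrite geo0.
by rewrite geoS -modnDmr -modnMm h IH modnMm mul1n modnDmr add1n.
Qed.

Lemma geo_gt0 x n : 0 < n -> 0 < geo x n.
Proof. by case: n => // n _; rewrite geoS. Qed.

Lemma geo_ge x n : x ^ n <= geo x n.+1.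
Proof. by rewrite /geo big_ord_recr /= leq_addl. Qed.

Lemma geo_le x n : 2 <= x -> geo x n <= x ^ n.
Proof.
move=> x2; rewrite -(geo_pred n) ?(ltnW x2) // -subn1.
have : geo x n * 1 <= geo x n * (x - 1) by rewrite leq_mul2l subn_gt0 x2 orbT.
lia.
Qed.

Lemma word_powS (T : Type) n (s : seq T) : word_pow n.+1 s = (s ++ word_pow n s)%SEQ.
Proof. by []. Qed.

Lemma size_word_pow (T : Type) n (s : seq T) : size (word_pow n s) = n * size s.
Proof. by elim: n => //= n IH; rewrite word_powS size_cat IH mulSn. Qed.

Lemma word_val_pow b n (s : seq 'I_b) :
  word_val (word_pow n s) = word_val s * geo (b ^ size s) n.
Proof.
elim: n => [|n IH]; first by rewrite geo0 muln0.
rewrite word_powS word_val_cat IH size_word_pow -mulnDr; congr muln.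
by rewrite /geo big_ord_recr addnC mulnC expnM.
Qed.

Lemma all_word_pow (T : Type) (a : pred T) n (s : seq T) :
  all a s -> all a (word_pow n s).
Proof. by move=> h; elim: n => //= n IH; rewrite word_powS all_cat h. Qed.

(** * Tail blocks, nodes and the two alternating steps *)

(* [u / y] is the number 0.vvv... in base b; [y] need not be its reduced denominator. *)
Record tail_block b (D : {set 'I_b}) (v : seq 'I_b) (u y : nat) : Prop := TailBlock {
  tb_in : all (mem D) v;
  tb_size : 0 < size v;
  tb_gt0 : 0 < y;
  tb_val : word_val v * y + u = u * b ^ size v;
  tb_mod : b ^ size v = 1 %[mod y] }.

(* [p / q] is 0.www... in base b and lies [e / (q y)] above [u / y] = 0.vvv... *)
Record periodic_node b (D : {set 'I_b}) (v : seq 'I_b) (u y : nat)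
    (w : seq 'I_b) (p q e : nat) : Prop := PeriodicNode {
  pn_in : all (mem D) w;
  pn_size : size v %| size w;
  pn_val : q * word_val w + p = p * b ^ size w;
  pn_dvd : exists c, b ^ size w = q * c + 1;
  pn_diff : p * y = u * q + e;
  pn_gt0 : 0 < e;
  pn_dvde : e %| b ^ size w;
  pn_le : b ^ size w <= q ^ 2;
  pn_q : 1 < q;
  pn_qN : q < b ^ size w }.

(* [p / q] is 0.sss... and [P / Q] is 0.svvv..., a Farey neighbour of it. *)
Record node_pair b (D : {set 'I_b}) (v : seq 'I_b) (u y : nat)
    (s : seq 'I_b) (p q P Q e : nat) : Prop := NodePair {
  np_in : all (mem D) s;
  np_size : size v %| size s;
  np_val : q * word_val s + p = p * b ^ size s;
  np_dvd : exists c, b ^ size s = q * c + 1;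
  np_diff : p * y = u * q + e;
  np_gt0 : 0 < e;
  np_dvde : e %| b ^ size s;
  np_Q : e * Q = y * b ^ size s;
  np_P : e * P = word_val s * y + u;
  np_det : p * Q = q * P + 1;
  np_le : b ^ size s <= Q ^ 2;
  np_q : 1 < q;
  np_qQ : q < Q;
  np_qN : q < b ^ size s }.

(** Both 0.sss... and 0.svvv... begin with [s], so they differ by [(p / q - u / y) / N ^ k], which
    is [e / (q * y * N ^ k)]. This equals [1 / (q * Q)] once [e * Q = y * N ^ k]. *)
Lemma node_pair_of_periodic b (D : {set 'I_b}) v u y w p q e k :
  tail_block D v u y -> periodic_node D v u y w p q e -> 2 <= k ->
  exists P Q, node_pair D v u y (word_pow k w) p q P Q e.
Proof.
move=> [vD v0 y0 vE vM] [wD wS wV [c wc] pE e0 eN Nq q1 qN] k2.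
set s := word_pow k w; set N := b ^ size w in wV wc eN Nq qN *.
have NE : b ^ size s = N ^ k by rewrite size_word_pow mulnC expnM.
have sV : word_val s = word_val w * geo N k by rewrite word_val_pow.
have N0 : 0 < N by rewrite wc addn1.
have sV1 : q * word_val s + p = p * N ^ k.
  have h : q * word_val w = p * N.-1 by move: wV N0; case: (N) => // n; rewrite mulnS /=; lia.
  by rewrite sV mulnA h -(geo_pred k N0); ring.
have [c' wc'] : exists c', N ^ k = q * c' + 1.
  exists (c * geo N k); rewrite -(geo_pred k N0).
  have -> : N.-1 = q * c by rewrite wc addn1.
  ring.
have eNk : e %| N ^ k.-1.
  by apply: dvdn_trans eN _; case: (k) k2 => [|[|m]] // _; rewrite expnS dvdn_mulr.
have eNk' : e %| N ^ k by case: (k) k2 eNk => // m _ h; rewrite expnS dvdn_mull.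
(* [N ^ k] is 1 modulo [q], so its divisor [e] is prime to [q], and divisibility by [e] may be
   tested after multiplying by [q]. *)
have cop : coprime e q.
  by apply: (coprime_dvdl eNk'); rewrite wc' coprime_sym /coprime mulnC gcdnMDl gcdn1.
have [P PE] : exists P, e * P = word_val s * y + u.
  have /dvdnP[P ->] : e %| word_val s * y + u; last by exists P; rewrite mulnC.
  rewrite -(Gauss_dvdr _ cop).
  have h : q * (word_val s * y + u) + e = N ^ k * (p * y).
    have -> : q * (word_val s * y + u) + e = (q * word_val s) * y + (u * q + e) by ring.
    rewrite -pE; have -> : N ^ k * (p * y) = (p * N ^ k) * y by ring.
    by rewrite -sV1; ring.
  have : e %| q * (word_val s * y + u) + e by rewrite h dvdn_mulr.
  by rewrite dvdn_addl.
have /dvdnP[r rE] := eNk.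
have kS : N ^ k = N ^ k.-1 * N by case: (k) k2 => // m _; rewrite expnS mulnC.
(* This is [y * N ^ k / e]. As [e <= N], it is at least [r * e = N ^ k.-1], which is at least
   [N > q] because [k >= 2]. *)
exists P, (y * r * N).
have QE : e * (y * r * N) = y * N ^ k by rewrite kS rE; ring.
have er : e * r = N ^ k.-1 by rewrite rE mulnC.
have NQ : N ^ k.-1 <= y * r * N.
  rewrite -er; have eN' : e <= N by exact: dvdn_leq.
  by rewrite -mulnA -{1}[e * r]mul1n leq_mul // mulnC leq_mul.
have NQ1 : N <= N ^ k.-1.
  by case: (k) k2 => [|[|m]] // _; rewrite expnS leq_pmulr // expn_gt0 N0.
have kQ : N ^ k <= (y * r * N) ^ 2.
  rewrite kS -mulnn; apply: leq_mul => //; exact: leq_trans NQ1 NQ.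
have qQ : q < y * r * N by exact: leq_trans qN (leq_trans NQ1 NQ).
have det : p * (y * r * N) = q * P + 1.
  apply/eqP; rewrite -(eqn_pmul2l e0).
  have -> : e * (p * (y * r * N)) = p * (e * (y * r * N)) by ring.
  have -> : e * (q * P + 1) = q * (e * P) + e by ring.
  rewrite QE PE.
  have -> : q * (word_val s * y + u) + e = q * word_val s * y + (u * q + e) by ring.
  by rewrite -pE -mulnDl sV1; apply/eqP; ring.
split; rewrite ?NE //; try by [exact: all_word_pow | exists c'].
- by rewrite size_word_pow dvdn_mull.
- by apply: (leq_trans qN); rewrite kS leq_pmull // expn_gt0 N0.
Qed.

(** Multiplying [q] by the geometric sum makes [q'] a divisor of [H ^ (j * y).+1 - 1], the natural
    denominator of the longer period. The exponent involves a multiple of [y] so that the numerator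
    [p'] comes out integral. *)
Lemma periodic_of_node_pair b (D : {set 'I_b}) v u y s p q P Q e j :
  tail_block D v u y -> node_pair D v u y s p q P Q e -> 0 < j ->
  exists n p' e', let q' := q * geo (b ^ size s) (j * y).+1 in
    periodic_node D v u y (s ++ word_pow n v)%SEQ p' q' e' /\
    p' * Q = q' * P + 1 /\ 2 * Q <= q' /\ 0 < n * size v.
Proof.
move=> [vD v0 y0 vE vM] [sD sS sV [c sc] pE e0 eH QE PE det HQ q1 qQ qH] j0.
set H := b ^ size s in sV sc eH QE HQ qH *.
have jy0 : 0 < j * y by rewrite muln_gt0 j0.
have H0 : 0 < H by rewrite sc addn1.
have /dvdnP[a aE] := sS.
have HM : H = 1 %[mod y].
  by rewrite /H aE mulnC expnM -modnXm vM modnXm exp1n.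
(* [H] is 1 modulo [y], hence [geo H (j * y)] is congruent to [j * y], that is to 0. *)
have [Z ZE] : exists Z, geo H (j * y) = y * Z.
  suff /dvdnP[Z ->] : y %| geo H (j * y) by exists Z; rewrite mulnC.
  by rewrite /dvdn (geo_mod _ HM) modnMl.
have Z0 : 0 < Z by have := geo_gt0 H jy0; rewrite ZE muln_gt0 => /andP[].
set G := H ^ (j * y).
have GE : G = 1 + H.-1 * (y * Z) by rewrite /G -(geo_pred _ H0) ZE addnC mulnC.
set g := geo H (j * y).+1.
have gE : g = 1 + H * (y * Z) by rewrite /g geoS ZE.
have [h hE] : exists h, H = h.+1 by exists H.-1; rewrite prednK.
have qV : q * word_val s = p * h by move: sV; rewrite hE mulnS [p + _]addnC => /addIn.
have {}GE : G = 1 + h * (y * Z) by rewrite GE hE.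
(* These [n] copies of [v] are as long as [j * y] copies of [s]. *)
pose n := a * (j * y).
have sizeE : size (s ++ word_pow n v)%SEQ = size s * (j * y).+1.
  by rewrite size_cat size_word_pow aE /n mulnS; ring.
have N'E : b ^ size (s ++ word_pow n v)%SEQ = H * G.
  by rewrite sizeE expnM expnS.
have B0 : 0 < b ^ size v.
  rewrite expn_gt0; case: (b) (v) v0 => [|//] w; by case: w => // -[].
have XE : word_val (word_pow n v) * y + u = u * G.
  have -> : G = (b ^ size v) ^ n by rewrite /G /H aE /n -!expnM; congr expn; ring.
  rewrite word_val_pow -(geo_pred n B0).
  have vE' : word_val v * y = u * (b ^ size v).-1.
    by move: vE B0; case: (b ^ size v) => // k; rewrite mulnS [u + _]addnC => /addIn.
  have -> : word_val v * geo (b ^ size v) n * y = (word_val v * y) * geo (b ^ size v) n by ring.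
  by rewrite vE'; ring.
pose w := (s ++ word_pow n v)%SEQ.
have wVy : word_val w * y + u = e * P * G.
  rewrite /w word_val_cat.
  have -> : size (word_pow n v) = size s * (j * y).
    by rewrite size_word_pow aE /n; ring.
  rewrite expnM -/H -/G PE mulnDl -addnA XE; ring.
(* The solution of [p' * Q = q * g * P + 1]: since [g = 1 + H * (y * Z)], the right side exceeds
   [p * Q] by [P * q * Z * (y * H)], and [y * H = e * Q]. *)
pose p' := p + P * q * e * Z.
have det' : p' * Q = q * g * P + 1.
  have -> : p' * Q = p * Q + P * q * Z * (e * Q) by rewrite /p'; ring.
  by rewrite QE det gE; ring.
have pE' : p' * y = u * (q * g) + e * G.
  have -> : p' * y = p * y + q * Z * y * (e * P) by rewrite /p'; ring.
  rewrite PE.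
  have -> : p * y + q * Z * y * (word_val s * y + u) =
            p * y + Z * y * ((q * word_val s) * y + u * q) by ring.
  rewrite qV.
  have -> : p * y + Z * y * (p * h * y + u * q) =
            p * y + Z * y * (h * (p * y) + u * q) by ring.
  by rewrite pE gE GE hE; ring.
have G0 : 0 < G by rewrite expn_gt0 H0.
have gH : H * (y * Z) <= g by rewrite gE leq_addl.
have Gg : G <= g by exact: geo_ge.
exists n, p', (e * G); split; last split => //; last split.
- split => //.
  + by rewrite all_cat sD all_word_pow.
  + by rewrite size_cat size_word_pow dvdn_add // dvdn_mull.
  + rewrite N'E -/w; apply/eqP; rewrite -(eqn_pmul2l y0).
    have -> : y * (q * g * word_val w + p') = q * g * (word_val w * y) + p' * y by ring.
    rewrite pE'.
    have -> : q * g * (word_val w * y) + (u * (q * g) + e * G) =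
      q * g * (word_val w * y + u) + e * G by ring.
    have -> : y * (p' * (H * G)) = G * (y * H) * p' by ring.
    rewrite wVy -QE.
    have -> : G * (e * Q) * p' = G * e * (p' * Q) by ring.
    by rewrite det'; apply/eqP; ring.
  + exists c; rewrite N'E -expnS -(geo_pred _ H0) -/g hE /=.
    have -> : h = q * c by apply: succn_inj; rewrite -hE sc addn1.
    ring.
  + by rewrite muln_gt0 e0 G0.
  + by rewrite N'E dvdn_mul.
  + rewrite N'E -mulnn; apply: leq_mul.
      have HG : H <= G by rewrite /G -(prednK jy0) expnS leq_pmulr // expn_gt0 H0.
      by apply: leq_trans HG _; apply: leq_trans Gg _; rewrite leq_pmull // ltnW.
    by apply: leq_trans Gg _; rewrite leq_pmull // ltnW.
  + by apply: (@leq_trans (2 * 1)) => //; apply: leq_mul => //; exact: leq_trans G0 Gg.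
  + rewrite N'E -expnS -(geo_pred _ H0) -/g addn1 ltnS mulnC leq_mul2l.
    by apply/orP; right; move: qH; rewrite hE.
- apply: leq_mul => //; apply: leq_trans gH.
  rewrite mulnA [H * y]mulnC -QE -mulnA mulnCA.
  by rewrite leq_pmulr // muln_gt0 e0.
- rewrite muln_gt0 v0 andbT /n muln_gt0 jy0 andbT.
  by case: (a) aE => // sz; move: (ltn_trans q1 qH); rewrite /H sz expn0.
Qed.

(** * Adjusting the number of repetitions to a prescribed size *)

(** Take the least [i] with [x <= F i]: either it is 0, or [F] was below [x] one step earlier and
    has grown by a factor of at most [G]. *)
Lemma first_above (F : nat -> nat) G x :
  0 < x -> F 0 <= G -> (forall i, F i.+1 <= G * F i) -> (forall i, i <= F i) ->
  exists i, x <= F i <= G * x.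
Proof.
move=> x0 F0 FS Fi.
have ex : exists i, x <= F i by exists x.
have [i xi imin] := ex_minnP ex.
exists i; rewrite xi /=; case: i xi imin => [|i] xi imin.
  by apply: leq_trans F0 _; rewrite leq_pmulr.
apply: leq_trans (FS i) _; rewrite leq_mul2l; apply/orP; right.
by rewrite leqNgt; apply/negP => /ltnW /imin; rewrite ltnn.
Qed.

(** One more copy of [w] multiplies [Q] by [b ^ size w], which is at most [q ^ 2]; so the size can
    be hit up to a factor polynomial in [q]. *)
Lemma node_pair_sized b (D : {set 'I_b}) v u y w p q e t :
  tail_block D v u y -> periodic_node D v u y w p q e -> 0 < t ->
  exists s P Q, node_pair D v u y (w ++ s)%SEQ p q P Q e /\
    t <= q * Q <= y * q ^ 5 * t.
Proof.
move=> tb pn t0; have [_ _ y0 _ _] := tb.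
have [_ _ _ _ _ e0 eN Nq q1 qN] := pn.
set N := b ^ size w in eN Nq qN.
have /dvdnP[r rE] := eN.
have N1 : 1 < N by exact: ltn_trans qN.
have r0 : 0 < r by case: (r) rE N1 => // ->.
(* The product [q * Q] for [i + 2] copies of [w], two copies being the minimum. *)
pose F i := q * (y * r * N ^ i.+1).
have c0 : 0 < q * (y * r) by rewrite !muln_gt0 y0 r0 (ltnW q1).
have [i /andP[ti iG]] : exists i, t <= F i <= y * q ^ 5 * t.
  apply: first_above => // [|i|i].
  - rewrite /F expn1.
    have rN : r <= N by rewrite rE leq_pmulr.
    have -> : y * q ^ 5 = q * (y * q ^ 2 * q ^ 2) by ring.
    rewrite leq_mul2l leq_mul ?orbT //.
    by rewrite leq_mul2l (leq_trans rN) ?orbT.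
  - have -> : F i.+1 = N * F i by rewrite /F [N ^ i.+2]expnS; ring.
    rewrite leq_mul2r; apply/orP; right; apply: leq_trans Nq _.
    have -> : y * q ^ 5 = q ^ 2 * (y * q ^ 3) by ring.
    by rewrite leq_pmulr // muln_gt0 y0 expn_gt0 (ltnW q1).
  - rewrite /F mulnA.
    apply: leq_trans (leq_pmull _ c0).
    by apply: ltnW; apply: ltnW; exact: ltn_expl.
have [P [Q np]] := node_pair_of_periodic (k := i.+2) tb pn isT.
exists (word_pow i.+1 w), P, Q; rewrite -word_powS; split => //.
have -> : Q = y * r * N ^ i.+1; last by rewrite ti iG.
apply/eqP; rewrite -(eqn_pmul2l e0) (np_Q np) size_word_pow [_ * size w]mulnC expnM -/N.
have -> : N ^ i.+2 = r * e * N ^ i.+1 by rewrite expnS -rE.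
by apply/eqP; ring.
Qed.

(** Raising [j] by one multiplies [q'] by at most [2 * H ^ y], and [H <= Q ^ 2]; the exponent of [Q]
    in the loss depends on [y] alone. *)
Lemma periodic_sized b (D : {set 'I_b}) v u y s p q P Q e t :
  tail_block D v u y -> node_pair D v u y s p q P Q e -> 0 < t ->
  exists x p' q' e', [/\ periodic_node D v u y (s ++ x)%SEQ p' q' e',
    0 < size x,
    p' * Q = q' * P + 1, 2 * Q <= q' &
    t <= Q * q' <= 2 * Q ^ (2 * y + 4) * t].
Proof.
move=> tb np t0; have [_ _ y0 _ _] := tb.
have [_ _ _ _ _ _ _ _ _ _ HQ q1 qQ qH] := np.
set H := b ^ size s in HQ qH.
have H2 : 2 <= H by exact: ltn_trans qH.
have Q0 : 0 < Q by exact: ltn_trans (ltnW q1) qQ.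
have Qq0 : 0 < Q * q by rewrite muln_gt0 Q0 (ltnW q1).
have HyQ : H ^ y <= Q ^ (2 * y) by rewrite expnM leq_exp2r.
(* The product [Q * q'] for [j = i + 1], as [j] has to be positive. *)
pose F i := Q * (q * geo H (i.+1 * y).+1).
have [i tiG] : exists i, t <= F i <= 2 * Q ^ (2 * y + 4) * t.
  apply: first_above => // [|i|i].
  - rewrite /F mul1n.
    have g1 : geo H y.+1 <= Q ^ (2 * y) * Q ^ 2.
      by apply: leq_trans (geo_le _ H2) _; rewrite expnSr leq_mul.
    have -> : 2 * Q ^ (2 * y + 4) = Q * (Q * (Q ^ (2 * y) * Q ^ 2)) * 2.
      by rewrite expnD; ring.
    apply: (@leq_trans (Q * (Q * (Q ^ (2 * y) * Q ^ 2)))); last by rewrite leq_pmulr.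
    by rewrite leq_mul2l leq_mul ?orbT // ltnW.
  - rewrite /F; have -> : (i.+2 * y).+1 = y + (i.+1 * y).+1 by rewrite mulSn addnS.
    rewrite geoD.
    set g := geo H (i.+1 * y).+1.
    have g1 : 0 < g by exact: geo_gt0.
    have gy : geo H y + H ^ y * g <= 2 * Q ^ (2 * y + 4) * g.
      have h1 : geo H y <= Q ^ (2 * y) * g.
        by apply: leq_trans (geo_le _ H2) _; apply: leq_trans HyQ _; rewrite leq_pmulr.
      have h2 : H ^ y * g <= Q ^ (2 * y) * g by rewrite leq_mul2r HyQ orbT.
      apply: leq_trans (leq_add h1 h2) _.
      rewrite addnn -mul2n mulnA leq_mul2r; apply/orP; right.
      by rewrite leq_mul2l /= expnD leq_pmulr // expn_gt0 Q0.
    have -> : 2 * Q ^ (2 * y + 4) * (Q * (q * g)) = Q * (q * (2 * Q ^ (2 * y + 4) * g)).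
      ring.
    by rewrite !leq_mul2l gy !orbT.
  - rewrite /F mulnA; apply: leq_trans (leq_pmull _ Qq0).
    apply: leq_trans (geo_ge _ _); apply: ltnW; apply: leq_trans (ltn_expl _ H2).
    by rewrite ltnS; apply: leq_trans (leqnSn i) _; rewrite leq_pmulr.
have [n [p' [e' /= [pn [det [QQ n0]]]]]] := periodic_of_node_pair (j := i.+1) tb np isT.
exists (word_pow n v), p', (q * geo H (i.+1 * y).+1), e'; split => //.
by rewrite size_word_pow.
Qed.

(** * Starting fractions *)

(** Split off the gcd with [b] until nothing is left. Each round uses one factor [b] and lowers [d],
    so the exponent [d] is enough. *)
Lemma split_coprime_part b d : 0 < d ->
  exists f g, [/\ d = f * g, coprime b g & f %| b ^ d].
Proof.
elim/ltn_ind: d => d IH d0.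
case: (boolP (coprime b d)) => [co|nco].
  by exists 1, d; rewrite mul1n dvd1n.
set g0 := gcdn b d.
have g01 : 1 < g0.
  by move: nco; rewrite /coprime -/g0 ltn_neqAle eq_sym gcdn_gt0 d0 orbT andbT.
have /dvdnP[d1 dE] : g0 %| d by exact: dvdn_gcdr.
have d10 : 0 < d1 by move: d0; rewrite dE muln_gt0 => /andP[].
have d1d : d1 < d by rewrite dE ltn_Pmulr.
have [f [g [d1E co fb]]] := IH _ d1d d10.
exists (g0 * f), g; split=> //; first by rewrite dE d1E; ring.
apply: (@dvdn_trans (b * b ^ d1)); first by rewrite dvdn_mul // dvdn_gcdl.
by rewrite -expnS dvdn_exp2l.
Qed.

Lemma tail_zero b (D : {set 'I_b}) (i0 : 'I_b) : i0 = 0 :> nat -> i0 \in D ->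
  tail_block D [:: i0] 0 1.
Proof. by move=> i00 iD; split => //=; rewrite ?iD // ?modn1 // /word_val /= i00. Qed.

Lemma start_zero_one b (D : {set 'I_b}) (i0 i1 : 'I_b) t :
  3 <= b -> i0 = 0 :> nat -> i1 = 1 :> nat -> i0 \in D -> i1 \in D -> 0 < t ->
  exists w q e, periodic_node D [:: i0] 0 1 w 1 q e /\ t <= q <= b.+1 * t.
Proof.
move=> b3 i00 i11 D0 D1 t0.
pose F i := (b ^ i.+1).-1.
have b1 : 1 < b by exact: ltnW.
have bp i : i.+1 < b ^ i.+1 by exact: ltn_expl.
have [n tn] : exists n, t <= F n <= b.+1 * t.
  apply: first_above => // [|i|i]; rewrite /F ?expn1.
  - by apply: leq_trans (leq_pred _) _.
  - have := bp i; have : b <= b ^ i.+1 by rewrite expnS leq_pmulr // expn_gt0 ltnW.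
    rewrite [b ^ i.+2]expnS; case: (b ^ i.+1) => // x; nia.
  - by have := bp i; case: (b ^ i.+1) => // x; rewrite ltnS => /ltnW.
have N0 : 0 < b ^ n.+1 by rewrite expn_gt0 (ltnW b1).
have N3 : 3 <= b ^ n.+1.
  by rewrite expnS; apply: leq_trans b3 _; rewrite leq_pmulr // expn_gt0 (ltnW b1).
pose w := (word_pow n [:: i0] ++ [:: i1])%SEQ.
have wS : size w = n.+1 by rewrite size_cat size_word_pow muln1 addn1.
have wV : word_val w = 1 by rewrite word_val_cat word_val_pow /word_val /= i00 i11.
exists w, (F n), 1; split => //; rewrite /F in tn *; split => //; rewrite ?wS ?wV //.
- by rewrite all_cat all_word_pow //= ?D0 // D1.
- by rewrite muln1 mul1n addn1 prednK.
- by exists 1; rewrite muln1 addn1 prednK.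
- case: (b ^ n.+1) N3 => [|[|[|x]]] // _ /=; rewrite -mulnn; nia.
- by case: (b ^ n.+1) N3 => [|[|[|x]]].
- by rewrite prednK.
Qed.

Lemma start_two_digits b (D : {set 'I_b}) (d c : 'I_b) :
  3 <= b -> d \in D -> c \in D -> d < c ->
  exists v u y w p q e, tail_block D v u y /\ periodic_node D v u y w p q e.
Proof.
move=> b3 dD cD dc.
have c0 : 0 < c by exact: leq_ltn_trans dc.
have b0 : 0 < b by exact: ltn_trans b3.
have delta0 : 0 < c - d by rewrite subn_gt0.
have [f [g [fgE cobg fb]]] := split_coprime_part b delta0.
have [f0 g0] : 0 < f /\ 0 < g by move: delta0; rewrite fgE muln_gt0 => /andP.
have [b' bE] : exists b', b = b'.+1 by exists b.-1; rewrite prednK.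
have b'0 : 0 < b' by rewrite -ltnS -bE; exact: ltn_trans b3.
(* One factor [b'] is used up in passing from [B - 1] to [geo b t]; the second makes [b'] divide
   [rho], which the integrality of [p] will need. *)
pose M := b' * b' * g.
have M0 : 0 < M by rewrite !muln_gt0 b'0 g0.
have cobM : coprime b M.
  have cb' : coprime b b' by rewrite bE coprimeSn.
  by rewrite !coprimeMr cb' cobg.
(* The totient makes [B] congruent to 1 modulo [M]; the factor [c - d] makes [f] divide [B]. *)
pose t := totient M * (c - d).
have t0 : 0 < t by rewrite muln_gt0 totient_gt0 M0.
set B := b ^ t.
have BM : B = 1 %[mod M].
  by rewrite /B /t expnM -modnXm Euler_exp_totient // modnXm exp1n.
have B0 : 0 < B by rewrite expn_gt0 b0.
have gB : geo b t * b' + 1 = B by rewrite /B -(geo_pred t b0) bE.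
have [r rE] : exists r, geo b t = g * (b' * r).
  have : M %| geo b t * b'.
    have /eqP := BM; rewrite -gB eqn_mod_dvd ?leq_addl // addnK //.
  rewrite /M -mulnA [geo b t * _]mulnC dvdn_pmul2l //.
  case/dvdnP=> r ->; exists r; ring.
pose rho := b' * r.
have rho0 : 0 < rho.
  by have := geo_gt0 b t0; rewrite rE muln_gt0 => /andP[].
have BE : B = 1 + b' * (g * rho) by rewrite -gB rE addnC mulnC.
pose y := b' * rho.
have BE' : B = 1 + g * y by rewrite BE /y; ring.
have y0 : 0 < y by rewrite muln_gt0 b'0.
have fc : f <= c * rho.
  apply: (@leq_trans (c - d)); first by rewrite fgE leq_pmulr.
  by apply: leq_trans (leq_subr _ _) _; rewrite leq_pmulr.
have [u uE] : exists u, u + f = c * rho by exists (c * rho - f); rewrite subnK.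
have v1 (x : 'I_b) : word_val [:: x] = x by [].
(* The value falls short of that of [t] digits [c] by [c - d = f * g], so it is
   [g * (c * rho - f) = g * u], and 0.vvv... is [g * u / (B - 1) = u / y]. *)
pose v := (word_pow t.-1 [:: c] ++ [:: d])%SEQ.
have vS : size v = t by rewrite size_cat size_word_pow muln1 addn1 prednK.
have vV : word_val v = g * u.
  have h : word_val v + (c - d) = c * geo b t.
    rewrite word_val_cat word_val_pow !v1 -[t in RHS]prednK // geoS /= !expn1.
    rewrite -addnA subnKC ?(ltnW dc) //; ring.
  apply/eqP; rewrite -(eqn_add2r (c - d)) h rE -/rho fgE.
  have -> : c * (g * rho) = g * (c * rho) by ring.
  by rewrite -uE; apply/eqP; ring.
have tb : tail_block D v u y.
  split; rewrite ?vS -/B ?vV //.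
  - by rewrite all_cat all_word_pow /= ?cD // dD.
  - by rewrite BE'; ring.
  - by rewrite BE' addnC modnMDl.
have /dvdnP[h hE] : f %| B.
  by apply: dvdn_trans fb _; rewrite dvdn_exp2l // leq_pmull // totient_gt0.
have h0 : 0 < h by move: B0; rewrite hE muln_gt0 => /andP[].
(* Modulo [y], [u * q + e] is [u * k.+1 + f], which this [k] turns into [c * rho * (1 + u * h)].
   Modulo [b'], [1 + u * h] agrees with [B + u * h = h * (f + u) = h * c * rho], hence vanishes; so
   [y = b' * rho] divides the product. *)
pose k := c * h * rho.
have k0 : 0 < k by rewrite muln_gt0 rho0 muln_gt0 c0 h0.
pose q := geo B k.+1.
pose e := f * B ^ k.
have /dvdnP[p pE] : y %| u * q + e.
  have Bm : B = 1 %[mod y] by have := tb_mod tb; rewrite vS.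
  have : u * q + e = u * k.+1 + f %[mod y].
    have em : e = f %[mod y] by rewrite /e -modnMmr -modnXm Bm modnXm exp1n modnMmr muln1.
    have qm : u * q = u * k.+1 %[mod y] by rewrite -modnMmr (geo_mod _ Bm) modnMmr.
    by rewrite -modnDm qm em modnDm.
  rewrite /dvdn => ->.
  have -> : u * k.+1 + f = c * rho * (1 + u * h).
    rewrite /k mulnS; have -> : u + u * (c * h * rho) + f = (u + f) + c * rho * (u * h) by ring.
    by rewrite uE; ring.
  have /dvdnP[x ->] : b' %| 1 + u * h.
    have e1 : (1 + u * h) + b' * (g * rho) = b' * (c * r * h).
      have -> : b' * (c * r * h) = (c * rho) * h by rewrite /rho; ring.
      by rewrite -uE mulnDl [f * h]mulnC -hE BE; ring.
    have : b' %| (1 + u * h) + b' * (g * rho) by rewrite e1 dvdn_mulr.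
    by rewrite dvdn_addl // dvdn_mulr.
  have -> : c * rho * (x * b') = (c * x) * y by rewrite /y; ring.
  by rewrite modnMl.
pose w := (word_pow t [:: c] ++ word_pow k v)%SEQ.
have wS : size w = t * k.+1.
  by rewrite size_cat !size_word_pow vS /=; ring.
have wV : word_val w = g * (y * p).
  rewrite word_val_cat !word_val_pow size_word_pow vS /= expn1 vV.
  rewrite [k * t]mulnC expnM -/B rE -/rho [y * p]mulnC -pE.
  rewrite /q /geo big_ord_recr /= -/(geo B k) /e.
  rewrite v1.
  have -> : c * (g * rho) * B ^ k = (g * (u + f)) * B ^ k by rewrite uE; ring.
  ring.
have B2 : 1 < B.
  by rewrite BE' -{1}[1]addn0 ltn_add2l muln_gt0 g0.
have BN : B ^ k.+1 = q * (g * y) + 1.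
  by rewrite -(geo_pred _ B0) -/q; congr (_ * _ + 1); rewrite BE'.
have Bq : B ^ k <= q by exact: geo_ge.
have q1 : 1 < q.
  by apply: leq_trans Bq; rewrite -(prednK k0) expnS;
    apply: leq_trans B2 _; rewrite leq_pmulr // expn_gt0 B0.
have NE : b ^ size w = B ^ k.+1 by rewrite wS expnM.
exists v, u, y, w, p, q, e; split => //; split; rewrite ?NE ?wV //.
- by rewrite all_cat !all_word_pow //= ?cD // (tb_in tb).
- by rewrite wS vS dvdn_mulr.
- by rewrite BN; ring.
- by exists (g * y).
- by rewrite muln_gt0 f0 expn_gt0 B0.
- by rewrite expnS dvdn_mul // hE dvdn_mull.
- rewrite expnS -mulnn leq_mul //; apply: leq_trans Bq.
  by rewrite -(prednK k0) expnS leq_pmulr // expn_gt0 B0.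
- by rewrite BN addn1 ltnS leq_pmulr // muln_gt0 g0.
Qed.

Local Open Scope classical_set_scope.
Local Open Scope ring_scope.

(** * Numbers with prescribed digits *)

Lemma word_val_lt b (s : seq 'I_b) : (word_val s < b ^ size s)%N.
Proof.
elim/last_ind: s => // s d IH.
rewrite /word_val foldl_rcons -/(word_val s) size_rcons expnS.
by have := ltn_ord d; nia.
Qed.

(** The hypothesis squeezes the partial sums between [x - b ^ (-n)] and [x]. The closed upper end
    admits both expansions of a b-adic rational. *)
Lemma missing_digit_set_word_val (R : realType) b (D : {set 'I_b}) (d : nat -> 'I_b)
    (x : R) : (1 < b)%N -> (forall k, d k \in D) ->
  (forall n, (word_val (mkseq d n))%:R <= x * b%:R ^+ n
             <= (word_val (mkseq d n)).+1%:R) ->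
  missing_digit_set D x.
Proof.
move=> b1 dD dx; split.
  by have := dx 0%N; rewrite expr0 mulr1.
exists d => //.
have bp n : 0 < b%:R ^+ n :> R by rewrite exprn_gt0 // ltr0n ltnW.
have seriesE n : series (fun k : nat => (d k)%:R / b%:R ^+ k.+1 : R) n
    = (word_val (mkseq d n))%:R / b%:R ^+ n.
  elim: n => [|n IH]; first by rewrite /series /= big_geq // mul0r.
  rewrite seriesSr IH mkseqS /word_val foldl_rcons -/(word_val _) natrD natrM exprS.
  field. by rewrite !gt_eqF // ?(bp 1%N) // -[b%:R]expr1.
have cvb : (fun n => x - (b%:R ^-1) ^+ n) @ \oo --> x.
  rewrite -[X in _ --> X]subr0; apply: cvgB; first exact: cvg_cst.
  apply: cvg_expr; rewrite ger0_norm ?invr_ge0 ?ler0n // invf_lt1 ?ltr1n //.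
  by rewrite ltr0n ltnW.
apply: (squeeze_cvgr _ cvb (cvg_cst x)).
near=> n; rewrite seriesE; have /andP[h1 h2] := dx n.
rewrite ler_pdivrMr // h1 andbT ler_pdivlMr // mulrBl exprVn mulVf ?gt_eqF //.
by rewrite lerBlDr natr1.
Unshelve. all: by end_near.
Qed.

(** The bounds pass from a word to its prefixes, because the remaining digits amount to less than
    one unit of the last place kept. *)
Lemma nested_words (R : realType) b (D : {set 'I_b}) (d0 : 'I_b)
    (s : nat -> seq 'I_b) (x : R) : (1 < b)%N -> (forall k, all (mem D) (s k)) ->
  (forall k, exists2 t, s k.+1 = (s k ++ t)%SEQ & (0 < size t)%N) ->
  (forall k, (word_val (s k))%:R <= x * b%:R ^+ size (s k)
             <= (word_val (s k)).+1%:R) ->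
  missing_digit_set D x.
Proof.
move=> b1 sD sS sx.
have sz k : (k <= size (s k))%N.
  elim: k => // k IH; have [t -> t0] := sS k.
  by rewrite size_cat -addn1 leq_add.
have pre k m : exists t, s (k + m)%N = (s k ++ t)%SEQ.
  elim: m => [|m [t tE]]; first by exists [::]; rewrite addn0 cats0.
  by rewrite addnS; have [t' -> _] := sS (k + m)%N; exists (t ++ t')%SEQ; rewrite tE catA.
(* The default [d0] is never returned: [s i.+1] has at least [i + 1] letters. *)
pose d i := nth d0 (s i.+1) i.
have dE n : mkseq d n = take n (s n).
  apply: (@eq_from_nth _ d0); first by rewrite size_mkseq size_takel.
  move=> i; rewrite size_mkseq => ni; rewrite nth_mkseq // nth_take // /d.
  have [t tE] := pre i.+1 (n - i.+1)%N.
  by rewrite subnKC // in tE; rewrite tE nth_cat sz.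
apply: (@missing_digit_set_word_val _ _ _ d) => // [k|n].
  by have /all_nthP := sD k.+1; apply; exact: sz.
rewrite dE; set w := take n (s n); set z := drop n (s n).
have := sx n; rewrite -(cat_take_drop n (s n)) -/w -/z word_val_cat size_cat.
have -> : size w = n by rewrite size_takel.
have bz : 0 < b%:R ^+ size z :> R by rewrite exprn_gt0 // ltr0n ltnW.
rewrite exprD mulrA => /andP[h1 h2]; apply/andP; split.
  rewrite -(ler_pM2r bz); apply: le_trans h1.
  by rewrite natrD natrM natrX lerDl ler0n.
rewrite -(ler_pM2r bz); apply: le_trans h2 _.
rewrite -natrX -natrM ler_nat mulSn addnC ltn_add2r.
exact: word_val_lt.
Qed.

(** The equation for [z] says that [z] is 0.vvv..., so behind [s] and any number of copies of [v]
    the remainder is again [z], which lies in [0, 1]. *)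
Lemma missing_digit_set_eventually_periodic (R : realType) b (D : {set 'I_b})
    (s v : seq 'I_b) (x z : R) : (1 < b)%N -> all (mem D) s -> all (mem D) v ->
  (0 < size v)%N -> z * b%:R ^+ size v = (word_val v)%:R + z ->
  x * b%:R ^+ size s = (word_val s)%:R + z ->
  missing_digit_set D x.
Proof.
case: v => // d0 v b1 sD; set w := d0 :: v => wD w0 zE xE.
have bw : b%:R ^+ size w = (b ^ size w)%:R :> R by rewrite natrX.
have B1 : (1 < b ^ size w)%N by rewrite -(expn0 b) ltn_exp2l.
have z01 : 0 <= z <= 1.
  have := word_val_lt w.
  move: zE B1; rewrite bw; case: (b ^ size w)%N => // k.
  rewrite -natr1 mulrDr mulr1 => /addIr zE; rewrite !ltnS => k0 wk.
  have k0' : 0 < k%:R :> R by rewrite ltr0n.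
  rewrite -(pmulr_lge0 _ k0') zE ler0n /= -(ler_pM2r k0') mul1r zE.
  by rewrite ler_nat.
apply: (@nested_words _ _ _ d0 (fun k => s ++ word_pow k w)%SEQ) => // [k|k|k].
- by rewrite all_cat sD all_word_pow.
- exists w => //; rewrite -catA; congr cat.
  elim: k => [|k IH]; first by rewrite word_powS cats0.
  by rewrite [LHS]word_powS {1}IH catA -word_powS.
- have zk : z * b%:R ^+ size (word_pow k w) = (word_val (word_pow k w))%:R + z.
    elim: k => [|k IH]; first by rewrite expr0 mulr1 add0r.
    rewrite word_powS size_cat exprD mulrA zE mulrDl IH word_val_cat natrD natrM natrX.
    by rewrite addrA.
  rewrite size_cat exprD mulrA xE mulrDl zk word_val_cat -natr1 natrD natrM natrX addrA.
  by have /andP[z0 z1] := z01; rewrite lerDl z0 lerD2l.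
Qed.

Lemma periodic_in (R : realType) b (D : {set 'I_b}) w p q : (1 < b)%N ->
  all (mem D) w -> (0 < size w)%N -> (0 < q)%N ->
  (q * word_val w + p = p * b ^ size w)%N -> missing_digit_set D (p%:R / q%:R : R).
Proof.
move=> b1 wD w0 q0 /(congr1 (fun n : nat => n%:R : R)).
rewrite natrD !natrM natrX => wE.
have qR : q%:R != 0 :> R by rewrite pnatr_eq0 -lt0n.
apply: (@missing_digit_set_eventually_periodic _ _ _ [::] w _ (p%:R / q%:R)) => //.
  by rewrite mulrAC -wE; field.
by rewrite expr0 mulr1 add0r.
Qed.

Lemma node_pair_in (R : realType) b (D : {set 'I_b}) v u y s p q P Q e : (1 < b)%N ->
  tail_block D v u y -> node_pair D v u y s p q P Q e ->
  missing_digit_set D (P%:R / Q%:R : R).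
Proof.
move=> b1 [vD v0 y0 vE _] [sD _ _ _ _ e0 _ QE PE _ _ _ qQ _].
have yR : y%:R != 0 :> R by rewrite pnatr_eq0 -lt0n.
have QR : Q%:R != 0 :> R by rewrite pnatr_eq0 -lt0n (leq_ltn_trans _ qQ).
have eR : e%:R != 0 :> R by rewrite pnatr_eq0 -lt0n.
move: vE QE PE => /(congr1 (fun n : nat => n%:R : R)) + /(congr1 (fun n : nat => n%:R : R))
  + /(congr1 (fun n : nat => n%:R : R)).
rewrite !natrD !natrM !natrX => vE QE PE.
apply: (@missing_digit_set_eventually_periodic _ _ _ s v _ (u%:R / y%:R)) => //.
  by rewrite mulrAC -vE; field.
apply: (mulfI (mulf_neq0 eR (mulf_neq0 QR yR))).
have -> : e%:R * (Q%:R * y%:R) * (P%:R / Q%:R * b%:R ^+ size s) =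
   e%:R * P%:R * (y%:R * b%:R ^+ size s) :> R by field.
by rewrite PE -QE; field.
Qed.

(** * Continued fractions *)

Lemma irrational_inv_frac (R : realType) (x : R) : irrational x ->
  let z := x - (Num.floor x)%:~R in [/\ 0 < z, 1 < z^-1 & irrational z^-1].
Proof.
move=> irr z.
have z0 : 0 < z.
  rewrite subr_gt0 lt_neqAle floor_le_tmp andbT; apply/eqP => xE.
  by apply: irr; exists (Num.floor x)%:~R => //; rewrite ratr_int.
have z1 : z < 1 by rewrite ltrBlDr addrC -intrD1 floorD1_gt.
split=> //; first by rewrite invf_gt1.
move=> [r _ rE]; apply: irr; exists (r^-1 + (Num.floor x)%:~R) => //.
by rewrite rmorphD /= fmorphV /= rE invrK ratr_int subrK.
Qed.

(* [t] is the complete quotient after depth n and [p' / q'] the previous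
   convergent, with [1 / 0] at depth 0. *)
Lemma cf_trunc_matrix (R : realType) n : forall x : R, irrational x ->
  exists (p p' q q' : int) (t : R),
    [/\ 1 <= q, (if n is 0%N then q' = 0 else 1 <= q'), 1 < t,
        p * q' - p' * q = 1 \/ p * q' - p' * q = -1 &
        [/\ x * (q%:~R * t + q'%:~R) = p%:~R * t + p'%:~R,
            cf_trunc x n = p%:~R / q%:~R & 1 < x -> 1 <= p /\ 1 <= p']].
Proof.
elim: n => [|n IH] x irr; have [z0 z1 zirr] := irrational_inv_frac irr;
  set a := Num.floor x in z0 z1 zirr *; set z := x - a%:~R in z0 z1 zirr.
- exists a, 1, 1, 0, z^-1; split => //; first by right; lia.
  split; rewrite /= ?divr1 //.
    by rewrite addr0 mul1r (_ : x = a%:~R + z) ?/z; [field; rewrite gt_eqF | ring].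
  by move=> x1; split => //; rewrite floor_ge_int ltW.
(* Prepending [a] multiplies the matrix of [z^-1] on the left by the one with rows (a, 1) and (1,
   0). Old numerators become denominators, which is why their positivity for arguments above 1 is
   part of the induction. *)
- have [p [p' [q [q' [t [q1 q'1 t1 det [xE cE h]]]]]]] := IH _ zirr.
  have [p1 p'1] := h z1.
  exists (a * p + q), (a * p' + q'), p, p', t; split => //.
    by case: det => det; [right|left]; move: det; nia.
  split.
  + have xz : x = a%:~R + z by rewrite /z; ring.
    have zE : p%:~R * t + p'%:~R = z^-1 * (q%:~R * t + q'%:~R) by rewrite xE.
    have {}zE : q%:~R * t + q'%:~R = z * (p%:~R * t + p'%:~R).
      by rewrite zE mulrA mulfV ?mul1r // gt_eqF.
    rewrite !rmorphD !rmorphM /=.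
    transitivity (a%:~R * (p%:~R * t + p'%:~R) + (q%:~R * t + q'%:~R)); last by ring.
    by rewrite zE {1}xz; ring.
  + rewrite /= -/a -/z cE; case: eqP => [xa|_].
      by move: z0; rewrite /z xa subrr ltxx.
    have pq : p%:~R != 0 :> rat by rewrite intr_eq0; lia.
    have qq : q%:~R != 0 :> rat by rewrite intr_eq0; lia.
    by rewrite rmorphD rmorphM /=; field; rewrite pq qq.
  + move=> x1; have a1 : 1 <= a by rewrite floor_ge_int ltW.
    have q'0 : 0 <= q' by case: (n) q'1 => [->|_] //; apply: le_trans.
    by split; nia.
Qed.

Lemma det_coprime (p p' q q' : int) :
  p * q' - p' * q = 1 \/ p * q' - p' * q = -1 -> coprimez p q.
Proof.
case=> det; apply/coprimezP.
  by exists (q', - p') => /=; lia.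
by exists (- q', p') => /=; lia.
Qed.

Lemma denq_div (p q : int) : 1 <= q -> coprimez p q ->
  denq (p%:~R / q%:~R : rat) = q.
Proof. by move=> q1 co; rewrite coprimeq_den // ifN ?ger0_norm //; lia. Qed.

(** Lagrange's argument: [(u, v)] has integer coordinates [(m, l)], [l <> 0], in the basis [(p, q)],
    [(p', q')], whose errors are [e] and [- t * e]; its own error is [(m - l * t) * e]. As
    [1 <= v <= q], [m] and [l] cannot have the same sign, whence [|m - l * t| > 1]. *)
Lemma best_approximation (R : realType) (x t : R) (p p' q q' u v : int) :
  1 <= q -> 1 <= q' -> 1 < t ->
  p * q' - p' * q = 1 \/ p * q' - p' * q = -1 ->
  x * (q%:~R * t + q'%:~R) = p%:~R * t + p'%:~R ->
  1 <= v <= q -> u * q <> v * p ->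
  `|q%:~R * x - p%:~R| < `|v%:~R * x - u%:~R|.
Proof.
move=> q1 q'1 t1 det xE /andP[v1 vq] ne.
set e := q%:~R * x - p%:~R.
have [m [l [uE vE]]] : exists m l, u = m * p + l * p' /\ v = m * q + l * q'.
  case: det => det.
    exists (u * q' - v * p'), (v * p - u * q); split.
      have -> : (u * q' - v * p') * p + (v * p - u * q) * p' = u * (p * q' - p' * q) by ring.
      by rewrite det mulr1.
    have -> : (u * q' - v * p') * q + (v * p - u * q) * q' = v * (p * q' - p' * q) by ring.
    by rewrite det mulr1.
  exists (v * p' - u * q'), (u * q - v * p); split.
    have -> : (v * p' - u * q') * p + (u * q - v * p) * p' = - (u * (p * q' - p' * q)) by ring.
    by rewrite det mulrN1 opprK.
  have -> : (v * p' - u * q') * q + (u * q - v * p) * q' = - (v * (p * q' - p' * q)) by ring.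
  by rewrite det mulrN1 opprK.
have l0 : l <> 0.
  by move=> l0; apply: ne; rewrite uE vE l0; ring.
have eE : q'%:~R * x - p'%:~R = - t * e.
  rewrite /e; apply/eqP; rewrite -subr_eq0; apply/eqP.
  have -> : q'%:~R * x - p'%:~R - - t * (q%:~R * x - p%:~R) =
    x * (q%:~R * t + q'%:~R) - (p%:~R * t + p'%:~R) by ring.
  by rewrite xE subrr.
have -> : v%:~R * x - u%:~R = (m%:~R - l%:~R * t) * e.
  rewrite uE vE !rmorphD !rmorphM /=.
  have -> : (m%:~R * q%:~R + l%:~R * q'%:~R) * x - (m%:~R * p%:~R + l%:~R * p'%:~R) =
     m%:~R * e + l%:~R * (q'%:~R * x - p'%:~R) by rewrite /e; ring.
  by rewrite eE; ring.
have e0 : e != 0.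
  apply/eqP => e0; move: eE; rewrite e0 mulr0 => /eqP; rewrite subr_eq0 => /eqP q'x.
  move: e0 => /eqP; rewrite subr_eq0 => /eqP qx.
  have : (p * q' - p' * q)%:~R = 0 :> R.
    by rewrite rmorphB !rmorphM /= -qx -q'x; ring.
  by case: det => -> /eqP; rewrite intr_eq0.
rewrite normrM ltr_pMl ?normr_gt0 //.
have [lp|ln] := ltP 0 l.
  have m0 : m <= 0 by move: vq; rewrite vE; nia.
  have mR : m%:~R <= 0 :> R by rewrite lerz0.
  have lR : 1 <= l%:~R :> R by rewrite ler1z; lia.
  rewrite ltr0_norm; nra.
have m1 : 1 <= m by move: v1; rewrite vE; nia.
have mR : 1 <= m%:~R :> R by rewrite ler1z.
have lR : l%:~R <= -1 :> R by rewrite -(mulrN1z 1) ?ler_int; lia.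
rewrite gtr0_norm; nra.
Qed.

(** Expand the convergent in the basis [(a, b)], [(c, d)]. If it is not [a / b], its denominator
    below [d] forces coordinates of opposite signs; the errors of the basis also have opposite
    signs, so the contributions add up and the convergent is no better than [a / b], against best
    approximation. *)
Lemma convergent_in_gap (R : realType) (x : R) (a b c d : int) n :
  irrational x -> 1 <= b ->
  a * d - c * b = 1 \/ a * d - c * b = -1 ->
  (b%:~R * x - a%:~R) * (d%:~R * x - c%:~R) < 0 ->
  b <= denq (cf_trunc x n) < d ->
  1 < b \/ Num.floor x = a ->
  cf_trunc x n = a%:~R / b%:~R.
Proof.
move=> irr b1 det sgn bd ba.
have [p [p' [q [q' [t [q1 q'1 t1 det' [xE cE _]]]]]]] := cf_trunc_matrix n irr.
have dE : denq (cf_trunc x n) = q by rewrite cE denq_div // (det_coprime det').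
rewrite dE in bd; move: bd => /andP[bq qd].
case: n q'1 cE dE => [|n] q'1 cE dE.
  have q1' : q = 1.
    have : p' <= -1 \/ p' = 0 \/ 1 <= p' by lia.
    by move: det'; rewrite q'1 mulr0 sub0r => -[] h [|[|]] h'; nia.
  have b1' : b = 1 by lia.
  by case: ba => [|<-]; [rewrite b1' ltxx | rewrite b1' divr1].
suff aqbp : a * q = b * p.
  rewrite cE; apply/eqP; rewrite eqr_div ?intr_eq0; try lia.
  by rewrite -!rmorphM /= aqbp mulrC.
apply/eqP/negPn/negP => /eqP ne.
have bq' : 1 <= b <= q by rewrite b1.
have := best_approximation q1 q'1 t1 det' xE bq' ne.
apply/negP; rewrite -leNgt.
have [m [l [pE qE]]] : exists m l, p = m * a + l * c /\ q = m * b + l * d.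
  case: det => det0.
    exists (p * d - q * c), (q * a - p * b); split.
      have -> : (p * d - q * c) * a + (q * a - p * b) * c = p * (a * d - c * b) by ring.
      by rewrite det0 mulr1.
    have -> : (p * d - q * c) * b + (q * a - p * b) * d = q * (a * d - c * b) by ring.
    by rewrite det0 mulr1.
  exists (q * c - p * d), (p * b - q * a); split.
    have -> : (q * c - p * d) * a + (p * b - q * a) * c = - (p * (a * d - c * b)) by ring.
    by rewrite det0 mulrN1 opprK.
  have -> : (q * c - p * d) * b + (p * b - q * a) * d = - (q * (a * d - c * b)) by ring.
  by rewrite det0 mulrN1 opprK.
have l0 : l <> 0 by move=> l0; apply: ne; rewrite pE qE l0; ring.
set f := b%:~R * x - a%:~R in sgn *; set g := d%:~R * x - c%:~R in sgn.
have -> : q%:~R * x - p%:~R = m%:~R * f + l%:~R * g.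
  by rewrite pE qE !rmorphD !rmorphM /= /f /g; ring.
have [lp|ln] := ltP 0 l.
  have m0 : m <= -1 by move: qd; rewrite qE; nia.
  have mR : m%:~R <= -1 :> R by rewrite -[-1](rmorphN1 intr) ler_int.
  have lR : 0 <= l%:~R :> R by rewrite ler0z; lia.
  have [f0|f0] := ltP f 0.
    have g0 : 0 < g by nra.
    rewrite (ltr0_norm f0) ger0_norm; nra.
  have g0 : g < 0 by nra.
  rewrite (ger0_norm f0) ler0_norm; nra.
have m1 : 1 <= m by move: (q1); rewrite qE; nia.
have mR : 1 <= m%:~R :> R by rewrite ler1z.
have lR : l%:~R <= 0 :> R by rewrite lerz0.
have [f0|f0] := ltP f 0.
  have g0 : 0 < g by nra.
  rewrite (ltr0_norm f0) ler0_norm; nra.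
have g0 : g < 0 by nra.
rewrite (ger0_norm f0) ger0_norm; nra.
Qed.

(** * Nested intervals of neighbouring fractions *)

(** Every number between [P / Q] and [p / q] thus has an expansion beginning with [s], as
    [nested_words] requires. *)
Lemma node_pair_val b (D : {set 'I_b}) v u y s p q P Q e : node_pair D v u y s p q P Q e ->
  (word_val s * Q <= P * b ^ size s)%N /\ (p * b ^ size s <= (word_val s).+1 * q)%N.
Proof.
move=> [_ _ sV _ _ e0 _ QE PE _ _ q1 _ qH]; split.
  rewrite -(leq_pmul2l e0).
  have -> : (e * (word_val s * Q) = word_val s * (e * Q))%N by ring.
  have -> : (e * (P * b ^ size s) = (e * P) * b ^ size s)%N by ring.
  rewrite QE PE mulnA leq_mul2r; apply/orP; right; exact: leq_addr.
have := word_val_lt s; move: sV; have := ltn_trans q1 qH.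
case: (b ^ size s)%N => [|[|h]] // _; rewrite ltnS => sV Vh.
rewrite -sV mulSn addnC mulnC leq_add2r.
have : (q * word_val s = p * h.+1)%N by move: sV; rewrite [(p * h.+2)%N]mulnS [(p + _)%N]addnC => /addIn.
nia.
Qed.

(* The two signed errors have opposite signs, so the determinant identity adds
   their absolute values. *)
Lemma neighbour_distances (R : realType) (x : R) (a b c d : nat) : (0 < b)%N ->
  (a * d = b * c + 1 \/ b * c = a * d + 1)%N ->
  (b%:R * x - a%:R) * (d%:R * x - c%:R) < 0 ->
  d%:R * `|b%:R * x - a%:R| + b%:R * `|d%:R * x - c%:R| = 1.
Proof.
move=> b0 det; set f := b%:R * x - a%:R; set g := d%:R * x - c%:R => sgn.
have fg : d%:R * f - b%:R * g = 1 \/ d%:R * f - b%:R * g = -1.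
  have -> : d%:R * f - b%:R * g = (b * c)%:R - (a * d)%:R :> R.
    by rewrite /f /g !natrM; ring.
  by case: det => ->; [right|left]; rewrite natrD; ring.
have d0 : 0 <= d%:R :> R by rewrite ler0n.
have b0' : 0 < b%:R :> R by rewrite ltr0n.
have [f0|f0] := ltP f 0.
  have g0 : 0 < g by nra.
  by rewrite (ltr0_norm f0) (gtr0_norm g0); case: fg => fg; nra.
have g0 : g < 0 by nra.
by rewrite (ger0_norm f0) (ltr0_norm g0); case: fg => fg; nra.
Qed.

(** Here [f] stands for the denominator that follows [d]. It makes [b * |d * x - c|] less than 1/2,
    and the sum in [neighbour_distances] leaves the other term between 1/2 and 1. *)
Lemma convergent_between_neighbours (R : realType) (x : R)
    (a b c d f n : nat) (r := cf_trunc x n) :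
  irrational x -> (0 < b)%N ->
  (a * d = b * c + 1 \/ b * c = a * d + 1)%N ->
  (b%:R * x - a%:R) * (d%:R * x - c%:R) < 0 ->
  f%:R * `|d%:R * x - c%:R| < 1 -> (2 * b <= f)%N ->
  (b <= den r < d)%N -> (1 < b)%N \/ a = 0%N /\ 0 < x < 1 ->
  [/\ ratr r = a%:R / b%:R :> R, den r = b &
      2^-1 < (b * d)%:R * `|x - ratr r| < 1].
Proof.
move=> irr b0 det sgn fg bf bd ba.
have rE : r = (a%:Z)%:~R / (b%:Z)%:~R.
  apply: (@convergent_in_gap R x a b c d n) => //.
  - by case: det => det; [left|right]; lia.
  - by move: bd; rewrite /den -/r; have := denq_gt0 r; lia.
  - case: ba => [b1|[-> /andP[x0 x1]]]; first by left.
    by right; apply/eqP; rewrite floor_eq add0r (ltW x0).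
have bE : denq r = b.
  rewrite rE denq_div //; apply: (@det_coprime _ c%:Z _ d%:Z).
  by case: det => det; [left|right]; lia.
have rR : ratr r = a%:R / b%:R :> R by rewrite rE fmorph_div /= !ratr_int.
split=> //; first by rewrite /den bE.
have bR : 0 < b%:R :> R by rewrite ltr0n.
have := neighbour_distances b0 det sgn.
have -> : (b * d)%:R * `|x - ratr r| = d%:R * `|b%:R * x - a%:R|.
  rewrite rR natrM mulrAC mulrC; congr (_ * _).
  rewrite -{1}(gtr0_norm bR) mulrC -normrM; congr `|_|.
  by field; rewrite gt_eqF.
set g := `|d%:R * x - c%:R| in fg *; set h := `|_| => e.
have g0 : 0 < g.
  rewrite normr_gt0; apply: contraTneq sgn => ->.
  by rewrite mulr0 ltxx.
have bg : 0 < b%:R * g by rewrite mulr_gt0.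
have bf' : 2 * b%:R <= f%:R :> R by rewrite -natrM ler_nat.
have : 2 * b%:R * g <= f%:R * g by rewrite ler_pM2r.
lra.
Qed.

(* The fractions are ordered P_0/Q_0 < P_1/Q_1 < ... < p_1/q_1 < p_0/q_0. *)
Record nested_fractions (p q P Q : nat -> nat) : Prop := NestedFractions {
  nf_det : forall k, (p k * Q k = q k * P k + 1)%N;
  nf_detS : forall k, (p k.+1 * Q k = q k.+1 * P k + 1)%N;
  nf_q : (1 < q 0)%N;
  nf_qQ : forall k, (q k < Q k)%N;
  nf_Qq : forall k, (2 * Q k <= q k.+1)%N }.

Lemma nested_fractions_gt1 p q P Q k : nested_fractions p q P Q ->
  (k.+1 < q k)%N /\ (k.+1 < Q k)%N.
Proof.
move=> nf; have [_ _ q0 qQ Qq] := nf.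
suff h : (k.+1 < q k)%N by split => //; exact: ltn_trans (qQ k).
elim: k => // k IH; have := qQ k; have := Qq k; lia.
Qed.

Lemma ltr_frac (R : realType) (a b c d : nat) : (0 < b)%N -> (0 < d)%N ->
  (a%:R / b%:R < c%:R / d%:R :> R) = (a * d < c * b)%N.
Proof.
move=> b0 d0; rewrite ltr_pdivrMr ?ltr0n // mulrAC ltr_pdivlMr ?ltr0n //.
by rewrite -!natrM ltr_nat.
Qed.

(** Two consecutive lower ends are both left neighbours of [p k.+1 / q k.+1], and the one with the
    larger denominator is closer; likewise for upper ends around [P k / Q k]. Strict monotonicity
    puts the supremum of the lower ends strictly inside every interval. *)
Lemma nested_fractions_limit (R : realType) p q P Q : nested_fractions p q P Q ->
  exists x : R, forall k, (P k)%:R / (Q k)%:R < x < (p k)%:R / (q k)%:R.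
Proof.
move=> nf; have [det detS _ qQ Qq] := nf.
have qp k : (0 < q k)%N by have [] := nested_fractions_gt1 k nf; lia.
have Qp k : (0 < Q k)%N by have [] := nested_fractions_gt1 k nf; lia.
pose A k : R := (P k)%:R / (Q k)%:R.
pose B k : R := (p k)%:R / (q k)%:R.
have AB k : A k < B k by rewrite ltr_frac // mulnC det addn1.
have AS k : A k < A k.+1.
  rewrite ltr_frac // -(ltn_pmul2l (qp k.+1)).
  have : (q k.+1 * (P k * Q k.+1) + Q k.+1 = q k.+1 * (P k.+1 * Q k) + Q k)%N.
    transitivity ((q k.+1 * P k + 1) * Q k.+1)%N; first by ring.
    rewrite -detS; transitivity ((q k.+1 * P k.+1 + 1) * Q k)%N; last by ring.
    by rewrite -det; ring.
  by have := qQ k.+1; have := Qq k; lia.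
have BS k : B k.+1 < B k.
  rewrite ltr_frac // -(ltn_pmul2r (Qp k)).
  have : (p k.+1 * q k * Q k + q k.+1 = p k * q k.+1 * Q k + q k)%N.
    transitivity (p k.+1 * Q k * q k + q k.+1)%N; first by ring.
    rewrite detS; transitivity (p k * Q k * q k.+1 + q k)%N; last by ring.
    by rewrite det; ring.
  by have := qQ k; have := Qq k; lia.
have Am k m : A k <= A (k + m)%N.
  by elim: m => [|m IH]; rewrite ?addn0 // addnS (le_trans IH) // ltW.
have Bm k m : B (k + m)%N <= B k.
  by elim: m => [|m IH]; rewrite ?addn0 // addnS (le_trans _ IH) // ltW.
have AB' k m : A m <= B k.
  apply: (le_trans (Am m k)); rewrite addnC; apply: le_trans (Bm k m).
  exact: ltW.
have ubB k : ubound (range A) (B k) by move=> _ [m _ <-].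
have ne : range A !=set0 by exists (A 0%N); exists 0%N.
exists (sup (range A)) => k; apply/andP; split.
  apply: lt_le_trans (AS k) _; apply: ub_le_sup; last by exists k.+1.
  by exists (B 0%N).
by apply: le_lt_trans (BS k); apply: ge_sup.
Qed.

Lemma nested_fractions_gaps (R : realType) p q P Q (x : R) k :
  nested_fractions p q P Q ->
  (forall k, (P k)%:R / (Q k)%:R < x < (p k)%:R / (q k)%:R) ->
  [/\ ((q k)%:R * x - (p k)%:R) * ((Q k)%:R * x - (P k)%:R) < 0,
      ((Q k)%:R * x - (P k)%:R) * ((q k.+1)%:R * x - (p k.+1)%:R) < 0,
      (Q k)%:R * `|(q k)%:R * x - (p k)%:R| < 1 &
      (q k.+1)%:R * `|(Q k)%:R * x - (P k)%:R| < 1].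
Proof.
move=> nf xk.
have [q1 Q1] : (0 < q k)%N /\ (0 < Q k)%N.
  by have [] := nested_fractions_gt1 k nf; lia.
have [q2 Q2] : (0 < q k.+1)%N /\ (0 < Q k.+1)%N.
  by have [] := nested_fractions_gt1 k.+1 nf; lia.
have lo k' : (0 < Q k')%N -> 0 < (Q k')%:R * x - (P k')%:R.
  move=> Q0; have /andP[+ _] := xk k'.
  by rewrite ltr_pdivrMr ?ltr0n // mulrC subr_gt0.
have hi k' : (0 < q k')%N -> (q k')%:R * x - (p k')%:R < 0.
  move=> Q0; have /andP[_ +] := xk k'.
  by rewrite ltr_pdivlMr ?ltr0n // mulrC subr_lt0.
have s1 : ((q k)%:R * x - (p k)%:R) * ((Q k)%:R * x - (P k)%:R) < 0.
  by rewrite nmulr_rlt0 ?lo ?hi.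
have s2 : ((Q k)%:R * x - (P k)%:R) * ((q k.+1)%:R * x - (p k.+1)%:R) < 0.
  by rewrite pmulr_rlt0 ?lo ?hi.
have e1 := neighbour_distances q1 (or_introl (nf_det nf k)) s1.
split => //.
  by rewrite -[ltRHS]e1 ltrDl mulr_gt0 ?ltr0n // normr_gt0 gt_eqF // lo.
have det2 : (Q k * p k.+1 = P k * q k.+1 + 1)%N.
  by rewrite mulnC (nf_detS nf) [(q _ * _)%N]mulnC.
have e2 := neighbour_distances Q1 (or_intror det2) s2.
by rewrite -[ltRHS]e2 ltrDl mulr_gt0 ?ltr0n // normr_gt0 lt_eqF // hi.
Qed.

(** If [x = a / c], then at index [c] the error [f] has [c * f] a nonzero integer, although
    [Q c * |f| < 1] and [Q c > c]. *)
Lemma nested_fractions_irrational (R : realType) p q P Q (x : R) :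
  nested_fractions p q P Q ->
  (forall k, (P k)%:R / (Q k)%:R < x < (p k)%:R / (q k)%:R) -> irrational x.
Proof.
move=> nf xk /rationalP [a [c xE]].
have [q1 Q1] := nested_fractions_gt1 c nf.
have [_ _ e1 _] := nested_fractions_gaps c nf xk.
have [s1 _ _ _] := nested_fractions_gaps c nf xk.
have c0 : (0 < c)%N.
  case: (c) xE => // xE0; move: (xk 0%N); rewrite xE0 invr0 mulr0 => /andP[].
  by rewrite ltNge divr_ge0 ?ler0n.
have cR : 0 < c%:R :> R by rewrite ltr0n.
set f := (q c)%:R * x - (p c)%:R in e1 s1.
have f0 : f != 0 by apply: contraTneq s1 => ->; rewrite mul0r ltxx.
have fE : c%:R * f = ((q c)%:Z * a - (p c)%:Z * c%:Z)%:~R.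
  by rewrite /f xE rmorphB !rmorphM /=; field; rewrite gt_eqF.
have f1 : 1 <= c%:R * `|f|.
  rewrite -[c%:R]gtr0_norm // -normrM fE -intr_norm ler1z.
  set z := `|_|; have : z != 0.
    rewrite normr_eq0; apply: contra f0 => /eqP z0.
    by move: fE; rewrite z0 => /eqP; rewrite mulf_eq0 gt_eqF.
  have : 0 <= z by exact: normr_ge0.
  lia.
have cQ : c%:R <= (Q c)%:R :> R by rewrite ler_nat; lia.
have : c%:R * `|f| <= (Q c)%:R * `|f| by rewrite ler_wpM2r.
lra.
Qed.

(** The interleaved denominators cut the half-line from [q 0] into ranges, and in each of them a
    neighbouring pair around [x] determines the convergent. *)
Lemma nested_fractions_convergents (R : realType) p q P Q (x : R) n
    (r := cf_trunc x n) : nested_fractions p q P Q ->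
  (forall k, (P k)%:R / (Q k)%:R < x < (p k)%:R / (q k)%:R) ->
  (q 0 <= den r)%N -> exists k,
  [/\ ratr r = (p k)%:R / (q k)%:R :> R, den r = q k &
      2^-1 < (q k * Q k)%:R * `|x - ratr r| < 1] \/
  [/\ ratr r = (P k)%:R / (Q k)%:R :> R, den r = Q k &
      2^-1 < (Q k * q k.+1)%:R * `|x - ratr r| < 1].
Proof.
move=> nf xk qr; have irr := nested_fractions_irrational nf xk.
have [k /andP[k1 k2]] : exists k, (q k <= den r < q k.+1)%N.
  have ex : exists k, (den r < q k)%N.
    by exists (den r); have [+ _] := nested_fractions_gt1 (den r) nf; lia.
  have [k rk kmin] := ex_minnP ex; case: k rk kmin => [|k] rk kmin; first by lia.
  exists k; rewrite rk andbT leqNgt; apply/negP => /kmin; lia.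
have [q1 Q1] : (1 < q k)%N /\ (1 < Q k)%N.
  by have [] := nested_fractions_gt1 k nf; lia.
have [s1 s2 _ e1] := nested_fractions_gaps k nf xk.
have [_ _ e2 _] := nested_fractions_gaps k.+1 nf xk.
have qQ := nf_qQ nf; have Qq := nf_Qq nf.
exists k; have [rQ|rQ] := ltnP (den r) (Q k).
  left; apply: (@convergent_between_neighbours R x _ _ _ _ (q k.+1)) => //; try lia.
  - by left; exact: nf_det nf k.
  - by have := qQ k; have := Qq k; lia.
  - by rewrite k1 rQ.
right; apply: (@convergent_between_neighbours R x _ _ _ _ (Q k.+1)) => //; try lia.
- by right; rewrite mulnC (nf_detS nf) [(q _ * _)%N]mulnC.
- by have := qQ k.+1; have := Qq k; lia.
- by rewrite rQ k2.
Qed.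

(** When [p 0 = 1], the fraction 0/1 is a left neighbour of [1 / q 0] and settles the remaining
    denominators below [q 0]. *)
Lemma nested_fractions_zero (R : realType) p q P Q (x : R) n
    (r := cf_trunc x n) : nested_fractions p q P Q ->
  (forall k, (P k)%:R / (Q k)%:R < x < (p k)%:R / (q k)%:R) -> p 0%N = 1%N ->
  Num.floor x = 0 /\ ((den r < q 0)%N ->
  [/\ ratr r = 0 :> R, den r = 1%N & 2^-1 < (1 * q 0)%N%:R * `|x - ratr r| < 1]).
Proof.
move=> nf xk p0; have irr := nested_fractions_irrational nf xk.
have [s1 s2 e1 _] := nested_fractions_gaps 0%N nf xk.
have q0 := nf_q nf.
have x0 : 0 < x.
  by have /andP[+ _] := xk 0%N; apply: le_lt_trans; rewrite divr_ge0 ?ler0n.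
have x1 : x < 1 / (q 0%N)%:R by have /andP[_] := xk 0%N; rewrite p0.
have x1' : x < 1.
  by apply: lt_trans x1 _; rewrite div1r invf_lt1 ?ltr1n // ltr0n ltnW.
have q0R : 0 < (q 0%N)%:R :> R by rewrite ltr0n ltnW.
split; first by apply/eqP; rewrite floor_eq add0r (ltW x0).
move=> rq.
suff : [/\ ratr r = 0%:R / 1%:R :> R, den r = 1%N &
           2^-1 < (1 * q 0)%N%:R * `|x - ratr r| < 1] by rewrite mul0r.
apply: (@convergent_between_neighbours R x 0 1 1 (q 0%N) (Q 0%N)) => //.
- by right.
- by rewrite mul1r subr0 pmulr_rlt0 // subr_lt0 mulrC -ltr_pdivlMr.
- by rewrite -p0.
- by have := nf_qQ nf 0%N; lia.
- by rewrite rq andbT /den absz_gt0 denq_neq0.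
- by right; rewrite x0 x1'.
Qed.

(** * Construction of the point *)

(** [T] prescribes products of consecutive denominators, because their reciprocals are, up to a
    factor 2, the distances from the limit to the fractions. The sequence is obtained by iterating a
    choice function on the states that satisfy the invariant. *)
Lemma node_pair_chain b (D : {set 'I_b}) v u y w p0 q0 e0 (T : nat -> nat) :
  tail_block D v u y -> periodic_node D v u y w p0 q0 e0 -> (forall q, (0 < T q)%N) ->
  exists (s : nat -> seq 'I_b) (p q P Q : nat -> nat),
  [/\ p 0%N = p0 /\ q 0%N = q0, nested_fractions p q P Q,
      (forall k, exists e, node_pair D v u y (s k) (p k) (q k) (P k) (Q k) e),
      (forall k, exists2 t, s k.+1 = (s k ++ t)%SEQ & (0 < size t)%N) &
      forall k, (T (q k) <= q k * Q k <= y * q k ^ 5 * T (q k))%N /\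
        (T (Q k) <= Q k * q k.+1 <= 2 * Q k ^ (2 * y + 4) * T (Q k))%N].
Proof.
move=> tb pn T0.
pose state := (seq 'I_b * (nat * nat) * (nat * nat) * nat)%type.
pose ss (a : state) := a.1.1.1.
pose sp (a : state) := a.1.1.2.1.
pose sq (a : state) := a.1.1.2.2.
pose sP (a : state) := a.1.2.1.
pose sQ (a : state) := a.1.2.2.
pose good (a : state) := node_pair D v u y (ss a) (sp a) (sq a) (sP a) (sQ a) a.2 /\
  (T (sq a) <= sq a * sQ a <= y * sq a ^ 5 * T (sq a))%N.
pose step (a a' : {a | good a}) := [/\
  exists2 t, ss (sval a') = (ss (sval a) ++ t)%SEQ & (0 < size t)%N,
  (sp (sval a') * sQ (sval a) = sq (sval a') * sP (sval a) + 1)%N,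
  (2 * sQ (sval a) <= sq (sval a'))%N &
  (T (sQ (sval a)) <= sQ (sval a) * sq (sval a')
    <= 2 * sQ (sval a) ^ (2 * y + 4) * T (sQ (sval a)))%N].
have [a0 [a0p a0q]] : exists a : {a | good a}, sp (sval a) = p0 /\ sq (sval a) = q0.
  have [s [P [Q [np TQ]]]] := node_pair_sized tb pn (T0 q0).
  have g : good ((w ++ s)%SEQ, (p0, q0), (P, Q), e0) by split.
  by exists (exist _ _ g).
have /choice[f fP] : forall a, exists a', step a a'.
  move=> [[[[s [p q]] [P Q]] e] [np TQ]].
  have [x [p' [q' [e' [pn' x0 det QQ TQ']]]]] := periodic_sized tb np (T0 Q).
  have [s' [P' [Q' [np' TQ'']]]] := node_pair_sized tb pn' (T0 q').
  have g : good (((s ++ x) ++ s')%SEQ, (p', q'), (P', Q'), e') by split.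
  exists (exist _ _ g); split => //.
  by exists (x ++ s')%SEQ; rewrite ?catA // size_cat addn_gt0 x0.
pose S k := iter k f a0.
have SP k : step (S k) (S k.+1) by exact: fP.
have SG k : good (sval (S k)) by exact: svalP.
exists (fun k => ss (sval (S k))), (fun k => sp (sval (S k))),
  (fun k => sq (sval (S k))), (fun k => sP (sval (S k))), (fun k => sQ (sval (S k))).
split => //.
- split=> [k|k||k|k].
  + by have [np _] := SG k; exact: np_det np.
  + by have [] := SP k.
  + by have [np _] := SG 0%N; exact: np_q np.
  + by have [np _] := SG k; exact: np_qQ np.
  + by have [] := SP k.
- by move=> k; have [np _] := SG k; exists (sval (S k)).2.
- by move=> k; have [] := SP k.
- by move=> k; have [_ ?] := SG k; have [_ _ _ ?] := SP k.
Qed.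

(** [K] dominates the coefficients [y], 2 and the exponents 5, [2 * y + 4] of the two steps; the
    summand [b] will absorb the factor [b + 1] of [start_zero_one]. *)
Lemma exists_point (R : realType) b (D : {set 'I_b}) v u y w p0 q0 e0 (T : nat -> nat)
    (K := (2 * y + 5 + b)%N) : (1 < b)%N ->
  tail_block D v u y -> periodic_node D v u y w p0 q0 e0 -> (forall q, (0 < T q)%N) ->
  exists x : R, [/\ missing_digit_set D x, irrational x,
    (forall n, let r := cf_trunc x n in (q0 <= den r)%N ->
      missing_digit_set D (ratr r : R) /\
      exists q, (T (den r) <= den r * q <= K * den r ^ K * T (den r))%N /\
        2^-1 < (den r * q)%:R * `|x - ratr r| < 1) &
    p0 = 1%N -> Num.floor x = 0 /\
      forall n, let r := cf_trunc x n in (den r < q0)%N ->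
      [/\ ratr r = 0 :> R, den r = 1%N & 2^-1 < (1 * q0)%N%:R * `|x - ratr r| < 1]].
Proof.
move=> b1 tb pn T0.
have [s [p [q [P [Q [[p0E q0E] nf np sS TK]]]]]] := node_pair_chain tb pn T0.
have [x xk] := nested_fractions_limit R nf.
have irr := nested_fractions_irrational nf xk.
have inB k : missing_digit_set D ((p k)%:R / (q k)%:R : R).
  have [e npk] := np k; have [sD _ sV _ _ _ _ _ _ _ _ q1 _ qH] := npk.
  apply: periodic_in sV => //; last exact: ltnW.
  by case: (s k) qH => //=; rewrite expn0 ltnS leqNgt ltnW.
have inA k : missing_digit_set D ((P k)%:R / (Q k)%:R : R).
  by have [e npk] := np k; exact: node_pair_in tb npk.
have qpos k : (0 < q k)%N /\ (0 < Q k)%N by have [] := nested_fractions_gt1 k nf; lia.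
exists x; split => //.
- have d0 : 'I_b := Ordinal (ltnW b1).
  apply: (@nested_words _ _ _ d0 s) => // k; first by have [e []] := np k.
  have [e npk] := np k; have [lo hi] := node_pair_val npk.
  have [qk Qk] := qpos k; have /andP[x1 x2] := xk k.
  have H0 : 0 < b%:R ^+ size (s k) :> R by rewrite exprn_gt0 // ltr0n ltnW.
  apply/andP; split.
    rewrite -ler_pdivrMr //; apply: le_trans (ltW x1).
    rewrite ler_pdivrMr // mulrAC ler_pdivlMr ?ltr0n // -natrX -!natrM ler_nat //.
  rewrite -ler_pdivlMr //; apply: le_trans (ltW x2) _.
  by rewrite ler_pdivlMr // mulrAC ler_pdivrMr ?ltr0n // -natrX -!natrM ler_nat.
- move=> n r; rewrite -q0E => qr.
  have Kb (m c z t : nat) : (0 < m)%N -> (c <= K)%N -> (z <= K)%N ->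
      (c * m ^ z * t <= K * m ^ K * t)%N.
    by move=> m0 cK zK; rewrite leq_mul2r leq_mul ?orbT // leq_pexp2l.
  have [k [[rE dE h]|[rE dE h]]] := nested_fractions_convergents nf xk qr;
    have [[/andP[h1 h2] /andP[h3 h4]] [qk Qk]] := (TK k, qpos k);
    rewrite rE dE.
    split=> //; exists (Q k); rewrite h1 -rE; split => //.
    by apply: (leq_trans h2); apply: Kb; rewrite // /K; lia.
  split=> //; exists (q k.+1); rewrite h3 -rE; split => //.
  by apply: (leq_trans h4); apply: Kb; rewrite // /K; lia.
- rewrite -p0E -q0E => p1.
  have h n := @nested_fractions_zero R p q P Q x n nf xk p1.
  by split=> [|n]; [have [] := h 0%N | have [] := h n].
Qed.

(** [K] and [c] must not depend on [T]. If 0 and 1 are in [D], the start does depend on it, since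
    its denominator follows that of 0/1 and must match [T 1], but [c = 1] does not. Otherwise the
    start is fixed by [D], and [c] is its denominator. *)
Lemma digit_set_points (R : realType) b (D : {set 'I_b}) : (3 <= b)%N -> (2 <= #|D|)%N ->
  exists K c : nat, [/\ (0 < K)%N, (forall i : 'I_b, (i < 2)%N -> i \in D) -> c = 1%N &
  forall T : nat -> nat, (forall q, (0 < T q)%N) -> exists x : R,
  [/\ missing_digit_set D x, irrational x,
    (forall r, convergents x r -> (c <= den r)%N -> missing_digit_set D (ratr r : R) /\
      exists q, (T (den r) <= den r * q <= K * den r ^ K * T (den r))%N /\
        2^-1 < (den r * q)%:R * `|x - ratr r| < 1) &
    (forall i : 'I_b, (i < 2)%N -> i \in D) -> Num.floor x = 0]].
Proof.
move=> b3 D2; have b1 : (1 < b)%N by exact: ltnW.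
have [D01|nD01] := pselect (forall i : 'I_b, (i < 2)%N -> i \in D).
- pose i0 : 'I_b := Ordinal (ltnW b1); pose i1 : 'I_b := Ordinal b1.
  have D0 : i0 \in D by exact: D01.
  exists (2 * 1 + 5 + b)%N, 1%N; split => //.
  move=> T T0; have tb : tail_block D [:: i0] 0 1 by exact: tail_zero.
  have [w [q0 [e [pn /andP[Tq qT]]]]] :=
    @start_zero_one b D i0 i1 (T 1%N) b3 erefl erefl D0 (D01 i1 isT) (T0 1%N).
  have [x [xD irr xc /(_ erefl)[x0 xr]]] := exists_point R b1 tb pn T0.
  exists x; split => // r [n _ <-] _.
  have [rq|rq] := ltnP (den (cf_trunc x n)) q0; last exact: xc.
  have [rE dE h] := xr n rq; rewrite rE dE; split.
    rewrite -[0](mul0r (1%:R^-1)).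
    by apply: (@periodic_in R b D [:: i0] 0%N 1%N) => //=; rewrite D0.
  exists q0; rewrite -rE; split => //; rewrite mul1n Tq exp1n muln1 /=.
  by apply: (leq_trans qT); rewrite leq_mul2r; apply/orP; right; lia.
- have [d [c [dD cD dc]]] : exists d c : 'I_b, [/\ d \in D, c \in D & (d < c)%N].
    have /card_gt1P[d [c [dD cD]]] := D2.
    by rewrite neq_ltn => /orP[]; [exists d, c | exists c, d].
  have [v [u [y [w [p [q [e [tb pn]]]]]]]] := start_two_digits b3 dD cD dc.
  exists (2 * y + 5 + b)%N, q; split => //; first by rewrite addn_gt0 (ltnW b1) orbT.
  move=> T T0; have [x [xD irr xc _]] := exists_point R b1 tb pn T0.
  by exists x; split => // r [n _ <-]; exact: xc.
Qed.

(** * From products of denominators to the approximation bounds *)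

(** Either [K <= eps * q] and exponents compare, or [q] is below [K / eps] and the constant
    suffices. *)
Lemma polynomial_le_powR (R : realType) (K q : nat) (eps : R) : 0 < eps -> (0 < q)%N ->
  q%:R ^+ K <= (1 + K%:R / eps) ^+ K * q%:R `^ (eps * q%:R).
Proof.
move=> eps0 q0; have q1 : 1 <= q%:R :> R by rewrite ler1n.
have qp : 0 < q%:R :> R by rewrite ltr0n.
have Ke : 0 <= K%:R / eps by rewrite divr_ge0 // ltW.
have [h|h] := leP K%:R (eps * q%:R).
  rewrite -[leLHS]mul1r ler_pM ?exprn_ge0 // ?exprn_ege1 ?lerDl //.
  by rewrite -powR_mulrn ?(ltW qp) //; exact: ler_powR.
have qK : q%:R <= 1 + K%:R / eps.
  rewrite ltW // (lt_le_trans _ (_ : K%:R / eps <= _)) ?lerDr //.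
  by rewrite ltr_pdivlMr // mulrC.
rewrite -[leLHS]mulr1; apply: ler_pM => //.
  by apply: lerXn2r => //; rewrite nnegrE ?(ltW qp) // addr_ge0.
by rewrite -[leLHS](powRr0 q%:R); apply: ler_powR => //; rewrite mulr_ge0 // ltW.
Qed.

(** [t] lies between [q ^ q / psi] and twice that, and [d] between [1 / (2 * q * m)] and
    [1 / (q * m)]; the two losses give the 4. [K'] belongs to one digit set, [K] is a common bound
    for all. *)
Lemma approximation_bounds (R : realType) (K K' q m : nat) (eps psi d : R)
    (t := ((Num.truncn psi^-1).+1 * q ^ q)%N) :
  0 < eps -> 0 < psi <= 1 -> (0 < q)%N -> (0 < K')%N -> (K' <= K)%N ->
  (t <= q * m <= K' * q ^ K' * t)%N -> 2^-1 < (q * m)%:R * d < 1 ->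
  d < Num.min psi (q%:R ^- q) /\
  (4 * K%:R * (1 + K%:R / eps) ^+ K)^-1 * q%:R `^ (- ((1 + eps) * q%:R)) * psi < d.
Proof.
move=> eps0 /andP[psi0 psi1] q0 K'0 KK /andP[t1 t2] /andP[d1 d2].
have q1 : 1 <= q%:R :> R by rewrite ler1n.
have qp : 0 < q%:R :> R by rewrite ltr0n.
have qqp : 0 < q%:R ^+ q :> R by rewrite exprn_gt0.
have psiV : 1 <= psi^-1 by rewrite invf_ge1.
have tr1 : psi^-1 < (Num.truncn psi^-1).+1%:R by exact: truncnS_gt.
have tr2 : (Num.truncn psi^-1)%:R <= psi^-1.
  by rewrite truncn_le // invr_ge0 ltW.
have tE : t%:R = (Num.truncn psi^-1).+1%:R * q%:R ^+ q :> R by rewrite natrM natrX.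
have tge : psi^-1 * q%:R ^+ q < t%:R by rewrite tE ltr_pM2r.
have tle : t%:R <= 2 * psi^-1 * q%:R ^+ q.
  by rewrite tE ler_pM2r // -natr1; lra.
have t0 : 0 < t%:R :> R by apply: lt_trans tge; rewrite mulr_gt0 ?invr_gt0.
have qm0 : 0 < (q * m)%:R :> R by apply: lt_le_trans t0 _; rewrite ler_nat.
have dp : 0 < d by rewrite -(pmulr_rgt0 _ qm0); apply: lt_trans d1.
have dt : psi^-1 * q%:R ^+ q * d < 1.
  apply: lt_trans d2; rewrite ltr_pM2r //; apply: lt_le_trans tge _.
  by rewrite ler_nat.
have qq1 : 1 <= q%:R ^+ q :> R by rewrite exprn_ege1.
have psiV0 : 0 < psi^-1 by rewrite invr_gt0.
split.
  rewrite lt_min; apply/andP; split.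
    rewrite -(ltr_pM2l psiV0) mulVf ?gt_eqF //; apply: le_lt_trans dt.
    by rewrite ler_pM2r // ler_peMr // ltW.
  rewrite -(ltr_pM2l qqp) mulfV ?gt_eqF //; apply: le_lt_trans dt.
  by rewrite ler_pM2r // ler_peMl // ltW.
have := polynomial_le_powR K eps0 q0; set X := (1 + _) ^+ K; set Y := _ `^ _ => XY.
have X0 : 0 < X by rewrite exprn_gt0 // ltr_wpDr // divr_ge0 // ltW.
have Y0 : 0 < Y by exact: powR_gt0.
have K0 : 0 < K%:R :> R by rewrite ltr0n; exact: leq_trans KK.
have -> : q%:R `^ (- ((1 + eps) * q%:R)) = (q%:R ^+ q)^-1 * Y^-1.
  rewrite powRN mulrDl mul1r powRD; last by apply/implyP => _; rewrite gt_eqF.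
  by rewrite powR_mulrn ?ltW // invfM.
have qm : (q * m)%:R <= K%:R * (X * Y) * (2 * psi^-1 * q%:R ^+ q).
  have h : (q * m <= K * q ^ K * t)%N.
    apply: (leq_trans t2); rewrite leq_mul2r; apply/orP; right.
    by apply: leq_mul => //; rewrite leq_pexp2l.
  apply: (@le_trans _ _ (K * q ^ K * t)%N%:R); first by rewrite ler_nat.
  rewrite natrM [(K * _)%:R]natrM natrX; apply: ler_pM => //.
  by rewrite ler_pM2l.
set Z := 4 * K%:R * X * (q%:R ^+ q) * Y * psi^-1.
have Z0 : 0 < Z by rewrite !mulr_gt0.
have -> : (4 * K%:R * X)^-1 * ((q%:R ^+ q)^-1 * Y^-1) * psi = Z^-1.
  by rewrite /Z; field; rewrite !gt_eqF.
rewrite -(ltr_pM2l Z0) mulfV ?gt_eqF //.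
have := ler_wpM2r (ltW dp) qm.
have -> : Z * d = 2 * (K%:R * (X * Y) * (2 * psi^-1 * q%:R ^+ q) * d).
  by rewrite /Z; ring.
lra.
Qed.

Theorem theorem1p1 (R : realType) (b : nat) (hb : (3 <= b)%N) :
  exists c2 : R -> R,
    (forall eps : R, 0 < eps -> 0 < c2 eps) /\
    forall D : {set 'I_b}, D \proper 'I_b -> (2 <= #|D|)%N ->
    exists c1 : R,
      ((forall i : 'I_b, (i < 2)%N -> i \in D) -> c1 = 1) /\
      forall (eps : R) (Psi : nat -> R),
        0 < eps ->
        (forall q : nat, (0 < q)%N -> 0 < Psi q <= 1) ->
        exists xi : R,
          [/\ missing_digit_set D xi,
              irrational xi,
              (forall r : rat, convergents xi r -> c1 <= (den r)%:R ->
                 [/\ missing_digit_set D (ratr r : R),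
                     `|xi - ratr r| < Num.min (Psi (den r)) ((den r)%:R ^- den r) &
                     c2 eps * (den r)%:R `^ (- ((1 + eps) * (den r)%:R)) * Psi (den r)
                       < `|xi - ratr r|]) &
              ((forall i : 'I_b, (i < 2)%N -> i \in D) ->
                 cf_trunc xi 0 = 0 /\
                 forall r : rat, convergents xi r -> missing_digit_set D (ratr r : R))].
Proof.
have /choice[K KP] : forall D : {set 'I_b}, exists K : nat, (2 <= #|D|)%N -> (0 < K)%N /\
    exists c : nat, ((forall i : 'I_b, (i < 2)%N -> i \in D) -> c = 1%N) /\
    forall T : nat -> nat, (forall q, (0 < T q)%N) -> exists x : R,
    [/\ missing_digit_set D x, irrational x,
      (forall r, convergents x r -> (c <= den r)%N -> missing_digit_set D (ratr r : R) /\
        exists q, (T (den r) <= den r * q <= K * den r ^ K * T (den r))%N /\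
          2^-1 < (den r * q)%:R * `|x - ratr r| < 1) &
      (forall i : 'I_b, (i < 2)%N -> i \in D) -> Num.floor x = 0].
  move=> D; have [D2|D2] := boolP (2 <= #|D|)%N; last by exists 0%N => D2'; case/negP: D2.
  have [K [c [K0 c1 h]]] := digit_set_points R hb D2.
  by exists K => _; split => //; exists c.
(* The maximum over the finitely many [D] makes [c2] depend on [b] and [eps] only; the successor
   keeps it positive. *)
pose M := (\max_(D : {set 'I_b}) K D).+1.
exists (fun eps => (4 * M%:R * (1 + M%:R / eps) ^+ M)^-1); split.
  move=> eps eps0; rewrite invr_gt0 mulr_gt0 //.
    by rewrite mulr_gt0 // ltr0n.
  by rewrite exprn_gt0 // ltr_wpDr // divr_ge0 // ltW.
move=> D _ D2; have [K0 [c [c1 ptP]]] := KP D D2.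
exists c%:R; split; first by move=> /c1 ->.
move=> eps Psi eps0 PsiP.
pose T q := ((Num.truncn (Psi q)^-1).+1 * (maxn 1 q) ^ q)%N.
have T0 q : (0 < T q)%N by rewrite muln_gt0 expn_gt0 leq_max.
have [x [xD irr xc x0]] := ptP T T0.
exists x; split => // [r cr|D01].
  rewrite ler_nat => cd; have [rD [q [tq dq]]] := xc r cr cd.
  have dr : (0 < den r)%N by rewrite /den absz_gt0 denq_neq0.
  have KM : (K D <= M)%N by apply: leqW; exact: leq_bigmax.
  move: tq; rewrite /T (maxn_idPr dr) => tq.
  by have [] := approximation_bounds eps0 (PsiP _ dr) dr K0 KM tq dq.
split; first by rewrite /= x0.
move=> r cr; apply: (proj1 (xc r cr _)).
by rewrite (c1 D01) /den absz_gt0 denq_neq0.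
Qed.
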